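(* Let $(K,v)$ be a valued field, $w$ an extension of $v$ to $K[x]$, and $\overline w$ any common extension of $w$ and $\bar v$ to $\overline K[x]$. Let $F\in K[x]$ be an abstract key polynomial for $w$ and $Q\in K[x]$ any monic polynomial. If $(F,Q)$ is a distinguished pair and $F$ is irreducible over $K^h$, then the following hold: (i) If $\theta$ and $\alpha$ are optimizing roots of $F$ and $Q$ respectively with respect to $\overline w$, then $(\theta,\alpha)$ is a $(K,v)$-distinguished pair. (ii) The polynomial $Q$ is an abstract key polynomial for $w$.
   Context: $(K,v)$ is a valued field of arbitrary rank, $\overline K$ a fixed algebraic closure, $\bar v$ a fixed extension of $v$ to $\overline K$, $K^h\subseteq\overline K$ the Henselization of $K$ with respect to $\bar v$, $\Gamma$ an ordered abelian group containing the value group of $\bar v$. A valuation on $K[x]$ extending $v$ is a map $w:K[x]\to\Gamma\cup\{\infty\}$ with $w(fg)=w(f)+w(g)$, $w(f+g)\ge\min\{w(f),w(g)\}$, restricting to $v$ on $K$ (its support $w^{-1}(\infty)$ may be nonzero). A common extension of $w$ and $\bar v$ is a valuation $\overline w$ on $\overline K[x]$ extending both. For $f\in K[x]$, $\delta(f)=\max\{\overline w(x-\alpha):\alpha\in\overline K,\ f(\alpha)=0\}$, which is independent of the choice of $\overline w$; a root of $f$ attaining this maximum is an optimizing root of $f$ (with respect to $\overline w$). A monic $Q\in K[x]$ is an abstract key polynomial for $w$ if $\delta(f)<\delta(Q)$ for every $f\in K[x]$ with $\deg f<\deg Q$. For $\alpha\in\overline K$, $\deg\alpha=[K(\alpha):K]$.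 $(\theta,\alpha)\in\overline K^2$ is a $(K,v)$-distinguished pair if: $\deg\theta>\deg\alpha$; $\bar v(\theta-\alpha)=\max\{\bar v(\theta-\beta):\beta\in\overline K,\ \deg\beta<\deg\theta\}$; and $\bar v(\theta-\eta)<\bar v(\theta-\alpha)$ for every $\eta\in\overline K$ with $\deg\eta<\deg\alpha$. For irreducible polynomials $f,g$ over $K$, $(g,f)$ is a distinguished pair if there are a root $\theta$ of $g$ and a root $\alpha$ of $f$ such that $(\theta,\alpha)$ is a $(K,v)$-distinguished pair. *)

(* Defs.v *)
From HB Require Import structures.
From mathcomp Require Import all_boot all_order all_algebra all_field.
From mathcomp Require Import boolp classical_sets.

Set Implicit Arguments.
Unset Strict Implicit.
Unset Printing Implicit Defensive.

Import Order.TTheory GRing.Theory Num.Theory.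

Local Open Scope classical_set_scope.
Local Open Scope ring_scope.

(* Totally ordered abelian groups, of arbitrary rank. *)

HB.mixin Record isOrderedGroup G of Num.POrderedZmodule G := {
  lez_total : forall x y : G, (x <= y) || (y <= x);
  lezD2l : forall z x y : G, x <= y -> z + x <= z + y
}.

#[short(type="orderedZmodType")]
HB.structure Definition OrderedZmodule :=
  { G of Num.POrderedZmodule G & isOrderedGroup G }.

(* [withInfty G] is G together with an element [infty] (encoded by [None])
   that is the greatest element and is absorbing for addition. *)

Definition withInfty (G : Type) : Type := option G.
Definition infty {G : Type} : withInfty G := None.

Section WithInfty.
Variable G : orderedZmodType.
Implicit Types x y z : withInfty G.

HB.instance Definition _ := Choice.on (withInfty G).

Definition inf_le x y : bool :=
  match x, y with
  | _, None => true
  | None, Some _ => false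
  | Some a, Some b => a <= b
  end.

Definition inf_lt x y : bool := (y != x) && inf_le x y.

Definition inf_add x y : withInfty G :=
  match x, y with
  | Some a, Some b => Some (a + b)
  | _, _ => infty
  end.

Fact inf_lt_def x y : inf_lt x y = (y != x) && inf_le x y.
Proof. by []. Qed.

Fact inf_le_refl : reflexive inf_le.
Proof. by case=> [a|] /=. Qed.

Fact inf_le_anti : antisymmetric inf_le.
Proof. by case=> [a|] [b|] //= /le_anti ->. Qed.

Fact inf_le_trans : transitive inf_le.
Proof. by case=> [a|] [b|] [c|] //=; apply: le_trans. Qed.

Fact inf_le_total : total inf_le.
Proof. by case=> [a|] [b|] //=; apply: lez_total. Qed.

HB.instance Definition _ := Order.isPOrder.Build ring_display (withInfty G)
  inf_lt_def inf_le_refl inf_le_anti inf_le_trans.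

HB.instance Definition _ :=
  Order.POrder_isTotal.Build ring_display (withInfty G) inf_le_total.

Fact inf_addA : associative inf_add.
Proof. by case=> [a|] [b|] [c|] //=; rewrite addrA. Qed.

Fact inf_addC : commutative inf_add.
Proof. by case=> [a|] [b|] //=; rewrite addrC. Qed.

Fact inf_add0 : left_id (Some 0 : withInfty G) inf_add.
Proof. by case=> [a|] //=; rewrite add0r. Qed.

HB.instance Definition _ :=
  GRing.isNmodule.Build (withInfty G) inf_addA inf_addC inf_add0.

End WithInfty.

Section Valuations.
Variable G : orderedZmodType.

(* Valuations on a ring; the support u^-1(infty) may be nonzero. *)
Definition valuation (R : comNzRingType) (u : R -> withInfty G) : Prop :=
  [/\ u 0 = infty,
      u 1 = 0,
      forall x y, u (x * y) = u x + u y
    & forall x y, Num.min (u x) (u y) <= u (x + y)].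

Definition field_valuation (K : fieldType) (v : K -> withInfty G) : Prop :=
  valuation v /\ forall x, v x = infty -> x = 0.

End Valuations.

Definition is_max (G : orderedZmodType) (A : set (withInfty G))
    (m : withInfty G) : Prop :=
  A m /\ ubound A m.

Section Setting.
(* [iota] embeds K into its algebraic closure L; vbar is a valuation on L. *)
Variables (G : orderedZmodType) (K : fieldType) (L : closedFieldType).
Variable iota : {rmorphism K -> L}.
Variable vbar : L -> withInfty G.

Definition algebraic_closure : Prop := forall a : L, algebraicOver iota a.

Definition extends_to_closure (v : K -> withInfty G) : Prop :=
  forall c : K, vbar (iota c) = v c.

Definition extends_to_poly (v : K -> withInfty G) (w : {poly K} -> withInfty G)
    : Prop :=
  forall c : K, w c%:P = v c.

Definition common_extension (w : {poly K} -> withInfty G)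
    (wbar : {poly L} -> withInfty G) : Prop :=
  [/\ valuation wbar,
      forall c : L, wbar c%:P = vbar c
    & forall f : {poly K}, wbar (map_poly iota f) = w f].

Definition Kroot (f : {poly K}) : set L :=
  [set a | root (map_poly iota f) a].

(* K(a), the smallest subfield of L containing K and a. *)
Definition adjoin (a : L) : set L :=
  smallest (fun S : set L => GRing.divring_closed (mem S))
           (range iota `|` [set a]).

(* b is a basis over K of the K-subspace V of L *)
Definition Kbasis (V : set L) (n : nat) (b : 'I_n -> L) : Prop :=
  (forall i, V (b i)) /\
  (forall x, V x -> exists! c : 'rV[K]_n, x = \sum_i iota (c 0 i) * b i).

(* deg a = [K(a) : K]; the default value 0 is never used for algebraic a. *)
Definition deg (a : L) : nat :=
  xget 0%N [set n : nat | exists b : 'I_n -> L, Kbasis (adjoin a) b].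

(* delta f is the maximum of wbar (x - a) over the roots a of f in L. It is
   meaningful for nonconstant f only; otherwise it is a default value. *)
Definition delta (wbar : {poly L} -> withInfty G) (f : {poly K})
    : withInfty G :=
  xget infty [set d | is_max [set wbar ('X - a%:P) | a in Kroot f] d].

Definition optimizing_root (wbar : {poly L} -> withInfty G) (f : {poly K})
    (a : L) : Prop :=
  Kroot f a /\ is_max [set wbar ('X - b%:P) | b in Kroot f] (wbar ('X - a%:P)).

(* The nonzero constants f, which have no root (delta f is the maximum of the
   empty set, i.e., "minus infinity"), impose no condition on Q. *)
Definition abstract_key_poly (wbar : {poly L} -> withInfty G) (Q : {poly K})
    : Prop :=
  Q \is monic /\
  forall f : {poly K}, (1 < size f < size Q)%N -> delta wbar f < delta wbar Q.

Definition distinguished_pair (theta alpha : L) : Prop :=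
  [/\ (deg alpha < deg theta)%N,
      is_max [set vbar (theta - beta) | beta in
                [set beta | (deg beta < deg theta)%N]]
             (vbar (theta - alpha))
    & forall eta, (deg eta < deg alpha)%N ->
        vbar (theta - eta) < vbar (theta - alpha)].

Definition distinguished_poly_pair (g f : {poly K}) : Prop :=
  [/\ irreducible_poly g, irreducible_poly f
    & exists theta alpha,
        [/\ Kroot g theta, Kroot f alpha & distinguished_pair theta alpha]].

(* a is separable over K: its minimal polynomial is separable *)
Definition separable_over (a : L) : Prop :=
  exists p : {poly K}, [/\ irreducible_poly p, separable_poly p & Kroot p a].

Definition decomposition_aut (sigma : {rmorphism L -> L}) : Prop :=
  [/\ bijective sigma,
      forall c : K, sigma (iota c) = iota c
    & forall a : L, vbar (sigma a) = vbar a].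

(* The Henselization of K in L with respect to vbar, as the decomposition field:
   the elements of the separable closure of K in L that are fixed by every
   K-automorphism of L preserving vbar. *)
Definition henselization : set L :=
  [set a | separable_over a /\
           forall sigma, decomposition_aut sigma -> sigma a = a].

(* Irreducibility of p in S[x], for S a subfield of L given as a set. *)
Definition irreducible_over (S : set L) (p : {poly L}) : Prop :=
  [/\ p \is a polyOver (mem S), (1 < size p)%N
    & forall q r : {poly L},
        q \is a polyOver (mem S) -> r \is a polyOver (mem S) ->
        p = q * r -> size q = 1%N \/ size r = 1%N].

End Setting.

(* Main.v *)
(** The pair of roots witnessing that (F, Q) is distinguished can be moved by the
    decomposition group, which acts transitively on the roots of F because F is
    irreducible over K^h; so every optimizing root theta of F has a distinguished
    partner a1 among the roots of Q.  As F is a key polynomial, every b of degree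
    less than deg F has wbar(x - b) < delta(F) = wbar(x - theta), hence
    wbar(x - b) = vbar(theta - b).  Thus maximizing wbar(x - b) among elements of
    small degree is the same as maximizing vbar(theta - b), and both claims are
    read off from the distinguished pair (theta, a1). *)

Require Import Defs.
From HB Require Import structures.
From mathcomp Require Import all_boot all_order all_algebra all_field.
From mathcomp Require Import boolp classical_sets.
Set Implicit Arguments.
Unset Strict Implicit.
Unset Printing Implicit Defensive.
Import Order.TTheory GRing.Theory Num.Theory.
Local Open Scope ring_scope.

(** * Finite subextensions of the algebraic closure *)

(** Brings finitely many elements of [L] into one [fieldExtType], where separability theory applies.
    One element is adjoined at a time; the induction varies [K] and [iota] because the remaining
    elements are treated over the enlarged base, and the resulting tower is then flattened to an
    extension of [K]. *)
Lemma finite_subextension (K : fieldType) (L : closedFieldType)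
    (iota : {rmorphism K -> L}) (s : seq L) :
  (forall a, a \in s -> algebraicOver iota a) ->
  exists (E : fieldExtType K) (j : {rmorphism E -> L}),
    (forall c : K, j c%:A = iota c) /\ forall a, a \in s -> exists e, j e = a.
Proof.
elim: s K iota => [|z s IHs] K iota alg_s.
  exists (K^o : fieldExtType K), iota; split=> // c.
  by congr (iota _); rewrite /GRing.scale /= mulr1.
have [|p [_ pz irr_p]] :=
    @minPoly_decidable_closure _ _ iota z (fun=> pselect _).
  by apply/integral_algebraic/alg_s; rewrite inE eqxx.
have p_neq0 := irredp_neq0 irr_p.
pose E1 : fieldExtType K := SubFieldExtType pz irr_p.
pose j1 : {rmorphism E1 -> L} := subfx_inj.
have j1K c : j1 c%:A = iota c by exact: subfx_inj_base.
have [a sa|E2 [j2 [j2E1 j2s]]] := IHs E1 j1.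
  have [|q q_neq0 qa] := alg_s a; first by rewrite inE sa orbT.
  exists (map_poly (in_alg E1) q); first by rewrite map_poly_eq0.
  by rewrite -map_poly_comp (eq_map_poly (g := iota)).
exists (baseFieldType E2), j2; split=> [c|a].
  by rewrite baseField_scaleE -j1K -j2E1.
rewrite inE => /predU1P[->|/j2s//].
exists (subfx_root iota z p : E1)%:A.
by rewrite j2E1; exact: subfx_inj_root.
Qed.

(** * Separable elements and the separable closure *)

Section Separable.
Variables (K : fieldType) (L : closedFieldType) (iota : {rmorphism K -> L}).
Variables (E : fieldExtType K) (j : {rmorphism E -> L}).
Hypothesis jK : forall c : K, j c%:A = iota c.

Let map_jK (p : {poly K}) :
  map_poly j (map_poly (in_alg E) p) = map_poly iota p.
Proof. by rewrite -map_poly_comp; apply: eq_map_poly => c /=. Qed.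

(** For the converse direction, the witness is the minimal polynomial of [e] over the subfield [1],
    whose coefficients come from [K]. *)
Lemma separable_overE (e : E) :
  separable_over iota (j e) <-> separable_element 1 e.
Proof.
split=> [[p [_ sep_p pe]]|sep_e].
  apply/separable_elementP; exists (map_poly (in_alg E) p); split.
  - by apply/polyOver1P; exists p.
  - by move: pe; rewrite /Kroot /= -map_jK fmorph_root.
  - by rewrite separable_map.
have /polyOver1P[p def_p] := minPolyOver 1 e.
exists p; split; first split.
- by rewrite -(size_map_poly (in_alg E)) -def_p size_minPoly.
- move=> q q_neq1 q_dv_p.
  have qE : map_poly (in_alg E) q \is a polyOver 1%VS.
    by apply/polyOver1P; exists q.
  have := minPoly_irr (x := e) qE; rewrite def_p -(rmorph1 (map_poly (in_alg E))).
  rewrite dvdp_map => /(_ q_dv_p) /orP[]; rewrite eqp_map //.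
  by rewrite -size_poly_eq1 (negPf q_neq1).
- by rewrite -(separable_map (in_alg E)) -def_p.
- by rewrite /Kroot /= -map_jK -def_p fmorph_root root_minPoly.
Qed.
End Separable.

Section SeparableClosure.
Variables (K : fieldType) (L : closedFieldType) (iota : {rmorphism K -> L}).
Hypothesis hL : algebraic_closure iota.

(** Two separable elements lie in a common finite extension [E], and there the subfield they
    generate is separable. *)
Lemma separable_over_divring_closed :
  GRing.divring_closed (mem [set a | separable_over iota a]%classic).
Proof.
(* The operation is quantified over all fields because it is computed in [E] and compared with its
   image in [L]; subtraction and division are the two instances. *)
have sep_closed (op : forall R : fieldType, R -> R -> R) a b :
    (forall (E : fieldExtType K) (j : {rmorphism E -> L}) (x y : E),
       j (op E x y) = op L (j x) (j y)) ->
    (forall (E : fieldExtType K) (U : {subfield E}) x y,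
       x \in U -> y \in U -> op E x y \in U) ->
    separable_over iota a -> separable_over iota b ->
    separable_over iota (op L a b).
  move=> j_op op_mem sa sb.
  have [x _|E [j [jK jab]]] := @finite_subextension _ _ iota [:: a; b].
    exact: hL.
  have [x def_a] := jab a (mem_head _ _); have [|y def_b] := jab b.
    by rewrite !inE eqxx orbT.
  move: sa sb; rewrite -def_a -def_b -j_op.
  move=> /(separable_overE jK) sx /(separable_overE jK) sy.
  apply/(separable_overE jK).
  have /separable_Fadjoin_seq/separableP : all (separable_element 1) [:: x; y].
    by rewrite /= sx sy.
  apply; apply: op_mem; apply: seqv_sub_adjoin; by rewrite !inE eqxx ?orbT.
split.
- rewrite inE /=; have [x|E [j [jK _]]] := @finite_subextension _ _ iota [::].
    by rewrite in_nil.
  rewrite -(rmorph1 j); apply/(separable_overE jK)/base_separable; exact: mem1v.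
- move=> a b; rewrite !inE; apply: (sep_closed (fun R x y => x - y)) => *.
    exact: rmorphB.
  exact: rpredB.
- move=> a b; rewrite !inE; apply: (sep_closed (fun R x y => x / y)) => *.
    exact: fmorph_div.
  exact: rpred_div.
Qed.

(** Each element has a separable power whose exponent is a power of the characteristic exponent. The
    product of these exponents serves the whole list, since powers of separable elements stay
    separable. *)
Lemma separable_over_exponent (s : seq L) :
  exists2 n, ([pchar L]%R).-nat n &
    forall a, a \in s -> separable_over iota (a ^+ n).
Proof.
have [a _|E [j [jK js]]] := @finite_subextension _ _ iota s; first exact: hL.
elim: s js => [|a s IHs] js; first by exists 1%N.
have [|n n_pchar sep_s] := IHs.
  by move=> b sb; apply: js; rewrite inE sb orbT.
have [e def_a] := js a (mem_head _ _).
have [m /andP[m_pchar sep_e]] := separable_exponent_pchar 1%AS e.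
exists (n * m)%N.
  rewrite pnatM n_pchar; apply: sub_in_pnat m_pchar => p _.
  by rewrite (fmorph_pchar j).
have sepX (x : E) k : separable_element 1 x -> separable_element 1 (x ^+ k).
  by move=> /adjoin_separableP; apply; rewrite rpredX ?memv_adjoin.
move=> b; rewrite inE => /predU1P[->|sb].
  rewrite mulnC exprM -def_a -!rmorphXn; apply/(separable_overE jK).
  exact: sepX.
have [|x def_b] := js b; first by rewrite inE sb orbT.
move: (sep_s b sb); rewrite exprM -def_b -!rmorphXn.
by move=> /(separable_overE jK) sx; apply/(separable_overE jK); exact: sepX.
Qed.
End SeparableClosure.

(** * Polynomials with coefficients in a subring or subfield *)

(** Long division: subtracting [u * d] cancels the leading term of [p], and since [d] is monic no
    coefficient leaves [S]. *)
Lemma polyOver_monic_division (R : idomainType) (S : subringClosed R)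
    (d p : {poly R}) :
  d \is monic -> d \is a polyOver S -> p \is a polyOver S ->
  exists q r, [/\ q \is a polyOver S, r \is a polyOver S, p = q * d + r
                & (size r < size d)%N].
Proof.
move=> d_monic Sd; have [m] := ubnP (size p); elim: m p => // m IHm p ltpm Sp.
have [ltpd|ledp] := ltnP (size p) (size d).
  by exists 0, p; split; rewrite ?rpred0 // mul0r add0r.
pose u : {poly R} := (lead_coef p)%:P * 'X^(size p - size d).
have Su : u \is a polyOver S.
  by rewrite rpredM ?polyOverXn // polyOverC (polyOverP Sp).
have [||q [r [Sq Sr def_p ltrd]]] := IHm (p - u * d).
- have p_gt0 : (0 < size p)%N.
    by apply: leq_trans ledp; rewrite size_poly_gt0 monic_neq0.
  have lc_p : lead_coef p != 0 by rewrite lead_coef_eq0 -size_poly_gt0.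
  have size_ud : size (u * d) = size p.
    by rewrite -mulrA size_Cmul // mulrC size_mulXn ?monic_neq0 // subnK.
  have lc_ud : lead_coef (u * d) = lead_coef p.
    by rewrite !lead_coefM lead_coefC lead_coefXn (monicP d_monic) !mulr1.
  apply: leq_trans (_ : _ < size p)%N _; last by rewrite -ltnS.
  rewrite -[X in (_ < X)%N](prednK p_gt0) ltnS; apply/leq_sizeP => i.
  rewrite leq_eqVlt coefB => /predU1P[<-|lti].
    by rewrite -lead_coefE -{1}lc_ud lead_coefE size_ud subrr.
  by rewrite !nth_default ?subr0 ?size_ud // -(prednK p_gt0).
- by rewrite rpredB // rpredM.
exists (q + u), r; split; rewrite ?rpredD //.
by rewrite mulrDl addrAC -def_p subrK.
Qed.

(** The minimal polynomial [d1] of [a] over [S] divides both [p] and [q], and irreducibility makes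
    [p] a constant multiple of [d1]. *)
Lemma irreducible_over_common_root (L : closedFieldType) (S : divringClosed L)
    (p q : {poly L}) (a : L) :
  irreducible_over [set x | x \in S]%classic p -> q \is a polyOver S ->
  root p a -> root q a -> forall b, root p b -> root q b.
Proof.
case=> Sp p_gt1 irr_p Sq pa qa b pb.
have eqS (r : {poly L}) :
    (r \is a polyOver (mem [set x | x \in S]%classic)) = (r \is a polyOver S).
  by rewrite !qualifE /=; apply: eq_all => x; apply/idP/idP => [/set_mem|/mem_set].
(* These are the sizes of the nonzero polynomials over [S] vanishing at [a]; one of least size
   becomes, after scaling, the minimal polynomial of [a]. *)
pose hasroot n := `[< exists d : {poly L},
  [/\ size d = n, d != 0, d \is a polyOver S & root d a] >].
have p_neq0 : p != 0 by rewrite -size_poly_gt0 ltnW.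
have [|n /asboolP[d [<- d_neq0 Sd da]] min_d] := @ex_minnP hasroot.
  by exists (size p); apply/asboolP; exists p; rewrite -eqS.
pose d1 := (lead_coef d)^-1 *: d.
have lc_neq0 : lead_coef d != 0 by rewrite lead_coef_eq0.
have d1_monic : d1 \is monic by rewrite monicE lead_coefZ mulVf.
have Sd1 : d1 \is a polyOver S by rewrite polyOverZ // rpredV (polyOverP Sd).
have d1a : root d1 a by rewrite rootZ // invr_eq0.
have dvd_d1 r : r \is a polyOver S -> root r a ->
    exists2 s, s \is a polyOver S & r = s * d1.
  move=> Sr ra.
  have [s [t [Ss St def_r lttd]]] := polyOver_monic_division d1_monic Sd1 Sr.
  exists s => //; move: ra; rewrite def_r rootE hornerD hornerM (rootP d1a).
  rewrite mulr0 add0r => ta.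
  have [->|t_neq0] := eqVneq t 0; first by rewrite addr0.
  have : hasroot (size t) by apply/asboolP; exists t; rewrite t_neq0.
  move=> /min_d; rewrite leqNgt -(size_scale d (_ : (lead_coef d)^-1 != 0)).
    by rewrite lttd.
  by rewrite invr_eq0.
have [s Ss def_p] := dvd_d1 p (etrans (esym (eqS p)) Sp) pa.
have [r Sr ->] := dvd_d1 q Sq qa.
have [||/eqP s1|d1_1] := irr_p s d1 _ _ def_p; rewrite ?eqS //; last first.
  by have := root_size_gt1 (monic_neq0 d1_monic) d1a; rewrite d1_1.
have /size_poly1P[c c_neq0 def_s] := s1.
move: pb; rewrite def_p def_s mul_polyC rootZ // rootM => ->.
by rewrite orbT.
Qed.

(** * The decomposition group and the Henselization *)

Lemma rmorph_Kroot (K : fieldType) (L : closedFieldType)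
    (iota : {rmorphism K -> L}) (sigma : {rmorphism L -> L}) (p : {poly K})
    (a : L) :
  (forall c, sigma (iota c) = iota c) ->
  Kroot iota p a -> Kroot iota p (sigma a).
Proof.
move=> sigmaK /(rmorph_root sigma).
by rewrite -map_poly_comp (eq_map_poly (g := iota)).
Qed.

Lemma decomposition_aut_comp (G : orderedZmodType) (K : fieldType)
    (L : closedFieldType) (iota : {rmorphism K -> L}) (vbar : L -> withInfty G)
    (s t : {rmorphism L -> L}) :
  decomposition_aut iota vbar s -> decomposition_aut iota vbar t ->
  decomposition_aut iota vbar (s \o t : {rmorphism L -> L}).
Proof.
case=> s_bij sK sv [t_bij tK tv]; split=> [|c|a] /=; first exact: bij_comp.
  by rewrite tK sK.
by rewrite sv tv.
Qed.

Section Henselization.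
Variables (G : orderedZmodType) (K : fieldType) (L : closedFieldType).
Variables (iota : {rmorphism K -> L}) (vbar : L -> withInfty G).
Hypothesis hL : algebraic_closure iota.

Lemma henselization_divring_closed :
  GRing.divring_closed (fun x : L => x \in henselization iota vbar).
Proof.
have [s1 sB sdiv] := separable_over_divring_closed hL.
split.
- apply/mem_set; split; first by move: s1; rewrite inE.
  by move=> sg _; rewrite rmorph1.
- move=> a b /set_mem[sa fa] /set_mem[sb fb]; apply/mem_set; split.
    by have := sB a b; rewrite !inE; apply.
  by move=> sg Dsg; rewrite rmorphB fa // fb.
- move=> a b /set_mem[sa fa] /set_mem[sb fb]; apply/mem_set; split.
    by have := sdiv a b; rewrite !inE; apply.
  by move=> sg Dsg; rewrite fmorph_div fa // fb.
Qed.

(* The orbit of a root under the decomposition group is the root set of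
   a polynomial over K^h: raising the roots to a power of the characteristic
   exponent makes the coefficients separable, and they are fixed by the group
   because it permutes the orbit. *)
Lemma irreducible_henselization_transitive (F : {poly K}) (a b : L) :
  irreducible_over (henselization iota vbar) (map_poly iota F) ->
  Kroot iota F a -> Kroot iota F b ->
  exists2 sigma, decomposition_aut iota vbar sigma & sigma a = b.
Proof.
move=> irrF Fa Fb; have [_ F_gt1 _] := irrF.
have [rs def_F] := closed_field_poly_normal (map_poly iota F).
have F_neq0 : map_poly iota F != 0 by rewrite -size_poly_gt0 ltnW.
have rootF c : root (map_poly iota F) c = (c \in rs).
  by rewrite def_F rootZ ?lead_coef_eq0 // root_prod_XsubC.
have [n n_pchar sep_n] := separable_over_exponent hL rs.
have n_gt0 : (0 < n)%N by case/andP: n_pchar.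
pose orb := [seq c <- undup rs |
  `[< exists2 sigma, decomposition_aut iota vbar sigma & sigma a = c >]].
pose P := \prod_(c <- orb) ('X^n - (c ^+ n)%:P).
have fixP sg : decomposition_aut iota vbar sg -> map_poly sg P = P.
  move=> Dsg; rewrite rmorph_prod /=.
  have -> : \prod_(c <- orb) map_poly sg ('X^n - (c ^+ n)%:P) =
      \prod_(c <- map sg orb) ('X^n - (c ^+ n)%:P).
    rewrite big_map; apply: eq_bigr => c _.
    by rewrite rmorphB /= map_polyXn map_polyC /= rmorphXn.
  apply: perm_big; apply: uniq_perm; rewrite ?filter_uniq ?undup_uniq //.
    by rewrite map_inj_uniq ?filter_uniq ?undup_uniq //; exact: fmorph_inj.
  (* An injective map of a finite set into itself is onto, so stability of the orbit is enough. *)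
  suff sub : {subset map sg orb <= orb}.
    have [||//] := uniq_min_size _ sub; last by rewrite size_map.
    by rewrite map_inj_uniq ?filter_uniq ?undup_uniq //; exact: fmorph_inj.
  move=> _ /mapP[c + ->]; rewrite !mem_filter !mem_undup.
  move=> /andP[/asboolP[t Dt <-] rs_c]; apply/andP; split.
    apply/asboolP; exists (sg \o t : {rmorphism L -> L}) => //.
    exact: decomposition_aut_comp.
  by case: Dsg => _ sgK _; move: rs_c; rewrite -!rootF; exact: rmorph_Kroot.
pose Ssep : divringClosed L := HB.pack
  (fun x : L => x \in [set a | separable_over iota a]%classic)
  (GRing.isDivringClosed.Build L _ (separable_over_divring_closed hL)).
have sepP : P \is a polyOver Ssep.
  rewrite /P big_seq; apply: rpred_prod => c; rewrite mem_filter mem_undup => /andP[_ rs_c].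
  by rewrite polyOverXnsubC; apply/mem_set/sep_n.
pose S : divringClosed L := HB.pack (fun x : L => x \in henselization iota vbar)
  (GRing.isDivringClosed.Build L _ henselization_divring_closed).
have SP : P \is a polyOver S.
  apply/polyOverP => i; apply/mem_set; split.
    by have /set_mem := polyOverP sepP i.
  by move=> sg Dsg; rewrite -coef_map fixP.
have orb_a : a \in orb.
  rewrite mem_filter mem_undup -rootF Fa andbT; apply/asboolP.
  by exists (idfun : {rmorphism L -> L}) => //; split=> //; exists id.
(* By Frobenius, [c ^+ n - d ^+ n] equals [(c - d) ^+ n], so passing to [n]-th powers creates no new
   roots. *)
have rootP c : root P c -> c \in orb.
  rewrite rootE horner_prod prodf_seq_eq0 => /hasP[d orb_d /=].
  rewrite !hornerE -{1}(subrK d c) exprDn_pchar // addrK expf_eq0 n_gt0 /=.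
  by rewrite subr_eq0 => /eqP->.
have Pa : root P a.
  rewrite rootE horner_prod prodf_seq_eq0; apply/hasP; exists a => //=.
  by rewrite !hornerE subrr.
have setS : [set x | x \in S]%classic = henselization iota vbar.
  by apply/seteqP; split=> x; [move=> /set_mem | move=> ?; apply/mem_set].
rewrite -setS in irrF.
have /rootP := irreducible_over_common_root irrF SP Fa Pa Fb.
by rewrite mem_filter => /andP[/asboolP[sg Dsg sga] _]; exists sg.
Qed.
End Henselization.

(** * Degrees of algebraic elements *)

(** Otherwise [p] and [q] would be coprime, and a Bezout relation evaluated at [a] would read 0 =
    1. *)
Lemma irreducible_dvdp_root (K : fieldType) (L : idomainType)
    (iota : {rmorphism K -> L}) (p q : {poly K}) (a : L) :
  irreducible_poly p -> root (map_poly iota p) a -> root (map_poly iota q) a ->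
  p %| q.
Proof.
move=> irr_p pa qa; apply/negPn; rewrite -irreducible_poly_coprime //.
apply/negP => /Bezout_eq1_coprimepP[[u v] /(congr1 (map_poly iota))] /=.
rewrite rmorphD !rmorphM rmorph1 => /(congr1 (fun r => r.[a])).
rewrite hornerD !hornerM (rootP pa) (rootP qa) !mulr0 addr0 hornerC => /esym/eqP.
by rewrite oner_eq0.
Qed.

Section Degree.
Variables (K : fieldType) (L : closedFieldType) (iota : {rmorphism K -> L}).

(** Applied in both directions, this makes the number chosen in [deg] well defined. If [A] and [B]
    express each basis in the other, uniqueness of coordinates forces [A *m B] to be the identity,
    which bounds [m] by [n]. *)
Lemma Kbasis_size_le (V : set L) (m n : nat) (b : 'I_m -> L) (c : 'I_n -> L) :
  Kbasis iota V b -> Kbasis iota V c -> (m <= n)%N.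
Proof.
move=> [Vb span_b] [Vc span_c].
have coord k l (d : 'I_k -> L) (e : 'I_l -> L) : (forall i, V (d i)) ->
    (forall x, V x -> exists! r : 'rV[K]_l, x = \sum_i iota (r 0 i) * e i) ->
    exists A : 'M[K]_(k, l), forall i, d i = \sum_j iota (A i j) * e j.
  move=> Vd span_e; have /choice[f fP] i : exists r : 'rV[K]_l,
      d i = \sum_j iota (r 0 j) * e j.
    by have [r [def_d _]] := span_e _ (Vd i); exists r.
  exists (\matrix_(i, j) f i 0 j) => i; rewrite {1}fP.
  by apply: eq_bigr => j _; rewrite mxE.
have [A bA] := coord _ _ b c Vb span_c; have [B cB] := coord _ _ c b Vc span_b.
apply: (@mulmx1_min _ _ _ A B); apply/row_matrixP => i.
have [r [_ r_uniq]] := span_b _ (Vb i).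
have <- : r = row i (A *m B).
  apply: r_uniq; rewrite {1}bA; under eq_bigr => j _ do rewrite cB mulr_sumr.
  rewrite exchange_big /=; apply: eq_bigr => k _.
  rewrite !mxE rmorph_sum mulr_suml; apply: eq_bigr => j _.
  by rewrite rmorphM mulrA.
apply: r_uniq; rewrite (bigD1 i) //= !mxE eqxx rmorph1 mul1r.
rewrite big1 ?addr0 // => j ji.
by rewrite !mxE eq_sym (negPf ji) rmorph0 mul0r.
Qed.

Variables (p : {poly K}) (a : L).
Hypotheses (irr_p : irreducible_poly p) (pa : Kroot iota p a).

(** The values at [a] already form a field: a Bezout relation between [p] and [r] yields the inverse
    of a nonzero value of [r]. *)
Lemma adjoin_horner : adjoin iota a =
  [set x | exists q : {poly K}, x = (map_poly iota q).[a]]%classic.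
Proof.
apply/seteqP; split=> x.
  move=> /(_ [set x | exists q : {poly K}, x = (map_poly iota q).[a]]%classic).
  apply; split; last first.
    move=> _ [[c _ <-]|->]; first by exists c%:P; rewrite map_polyC hornerC.
    by exists 'X; rewrite map_polyX hornerX.
  split.
  - by apply/mem_set; exists 1; rewrite rmorph1 hornerC.
  - move=> _ _ /set_mem[q ->] /set_mem[r ->]; apply/mem_set; exists (q - r).
    by rewrite rmorphB hornerD hornerN.
  - move=> _ _ /set_mem[q ->] /set_mem[r ->]; apply/mem_set.
    (* Closure under division includes division by 0, where the inverse is 0 by convention. *)
    have [r0|r_neq0] := eqVneq (map_poly iota r).[a] 0.
      by exists 0; rewrite r0 invr0 mulr0 rmorph0 horner0.
    have /Bezout_eq1_coprimepP[[u v] /= bez] : coprimep p r.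
      rewrite irreducible_poly_coprime //; apply: contra r_neq0 => /dvdpP[s ->].
      by rewrite rmorphM hornerM (rootP pa) mulr0.
    exists (q * v); rewrite rmorphM hornerM; congr (_ * _).
    apply: (mulIf r_neq0); rewrite mulVf //.
    rewrite -hornerM -rmorphM.
    have := congr1 (fun s => (map_poly iota s).[a]) bez.
    rewrite rmorphD !rmorphM rmorph1 hornerD !hornerM hornerC (rootP pa).
    by rewrite mulr0 add0r.
move=> [q ->] S [Sdiv SKa].
pose S' : divringClosed L := HB.pack (fun x : L => x \in S)
  (GRing.isDivringClosed.Build L _ Sdiv).
suff : (map_poly iota q).[a] \in S' by move=> /set_mem.
rewrite rpred_horner //; last by apply/mem_set/SKa; right.
by apply/polyOverP => i; rewrite coef_map; apply/mem_set/SKa; left; exists q`_i.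
Qed.

(** The powers of [a] below the degree of [p] form a basis: reduction modulo [p] gives the
    coordinates, and they are unique because [p] divides no nonzero polynomial of smaller size. *)
Lemma deg_irreducible : deg iota a = (size p).-1.
Proof.
pose b (i : 'I_(size p).-1) := a ^+ i.
have p_neq0 := irredp_neq0 irr_p.
have p_gt0 : (0 < size p)%N by rewrite size_poly_gt0.
have hornerE (c : 'rV[K]_(size p).-1) :
    (map_poly iota (rVpoly c)).[a] = \sum_i iota (c 0 i) * b i.
  rewrite (@horner_coef_wide _ (size p).-1); last first.
    by rewrite size_map_poly size_poly.
  by apply: eq_bigr => i _; rewrite coef_map coef_rVpoly_ord.
have basis_b : Kbasis iota (adjoin iota a) b.
  rewrite adjoin_horner; split=> [i|_ [q ->]].
    by exists 'X^i; rewrite map_polyXn hornerXn.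
  exists (poly_rV (q %% p)); split.
    rewrite -hornerE poly_rV_K; last by rewrite -ltnS prednK // ltn_modp.
    rewrite {1}(divp_eq q p) rmorphD rmorphM hornerD hornerM (rootP pa).
    by rewrite mulr0 add0r.
  move=> c qc; rewrite -[RHS]rVpolyK; congr poly_rV.
  have /(irreducible_dvdp_root irr_p pa) :
      root (map_poly iota (q - rVpoly c)) a.
    by rewrite rootE rmorphB hornerD hornerN hornerE -qc subrr.
  rewrite -[_ %| _]/((q - rVpoly c) %% p == 0) modpD modpN subr_eq0 => /eqP->.
  by rewrite modp_small //; apply: leq_ltn_trans (size_poly _ _) _; rewrite ltn_predL.
(* A basis exists, so [deg] does not fall back on its default value 0. *)
have [c basis_c] : exists c : 'I_(deg iota a) -> L, Kbasis iota (adjoin iota a) c.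
  apply: (@xgetPex _ 0%N
    [set n | exists c : 'I_n -> L, Kbasis iota (adjoin iota a) c]%classic).
  by exists (size p).-1, b.
apply/eqP; rewrite eqn_leq (Kbasis_size_le basis_c basis_b).
exact: Kbasis_size_le basis_b basis_c.
Qed.
End Degree.

Section DegreeAlgebraic.
Variables (K : fieldType) (L : closedFieldType) (iota : {rmorphism K -> L}).
Hypothesis hL : algebraic_closure iota.

Lemma minimal_polynomial (a : L) : exists p : {poly K},
  [/\ irreducible_poly p, Kroot iota p a & size p = (deg iota a).+1].
Proof.
have [|p [_ pa irr_p]] :=
    @minPoly_decidable_closure _ _ iota a (fun=> pselect _).
  by apply/integral_algebraic/hL.
exists p; split=> //; rewrite (deg_irreducible irr_p pa) prednK // size_poly_gt0.
exact: irredp_neq0.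
Qed.

Lemma deg_root_lt (f : {poly K}) (a : L) :
  f != 0 -> Kroot iota f a -> (deg iota a < size f)%N.
Proof.
move=> f_neq0 fa; have [p [irr_p pa sz_p]] := minimal_polynomial a.
by rewrite -sz_p; apply: dvdp_leq => //; exact: irreducible_dvdp_root fa.
Qed.

Lemma deg_conjugate (sigma : {rmorphism L -> L}) (a : L) :
  (forall c, sigma (iota c) = iota c) -> deg iota (sigma a) = deg iota a.
Proof.
move=> sigmaK; have [p [irr_p pa sz_p]] := minimal_polynomial a.
by rewrite (deg_irreducible irr_p (rmorph_Kroot sigmaK pa)) sz_p.
Qed.
End DegreeAlgebraic.

(** * Elementary properties of valuations *)

Section Valuation.
Variables (G : orderedZmodType) (R : comNzRingType) (u : R -> withInfty G).
Hypothesis hu : valuation u.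

(** Twice [u (-1)] is [u 1 = 0], so [u (-1)] is finite; it vanishes because an element of an ordered
    group equal to its own opposite is 0. *)
Lemma valuationN (x : R) : u (- x) = u x.
Proof.
have [u0 u1 uM _] := hu.
suff uN1 : u (-1) = 0 by rewrite -mulN1r uM uN1 add0r.
have : u (-1) + u (-1) = 0 by rewrite -uM mulrNN mulr1 u1.
case: (u (-1)) => // c [cc0]; congr Some.
have cN : - c = c by apply/esym/eqP; rewrite -addr_eq0 cc0.
apply/le_anti; have /orP[le0c|lec0] := lez_total 0 c.
  by have := lezD2l (- c) _ _ le0c; rewrite addr0 addNr cN le0c andbT.
by have := lezD2l (- c) _ _ lec0; rewrite addr0 addNr cN lec0.
Qed.

(** If [u (x + y)] exceeded [u x], then writing [x] as [(x + y) - y] would give [u x] a value above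
    itself. *)
Lemma valuationD_lt (x y : R) : u x < u y -> u (x + y) = u x.
Proof.
move=> xy; have [_ _ _ uD] := hu; apply/eqP; rewrite eq_le.
have := uD x y; rewrite (min_l (ltW xy)) => ->; rewrite andbT leNgt; apply/negP => lt_x.
have := uD (x + y) (- y); rewrite addrK valuationN leNgt => /negP; apply.
by rewrite lt_min lt_x xy.
Qed.
End Valuation.

(** * Existence of optimizing roots *)

Lemma total_seq_argmax (d : Order.disp_t) (T : orderType d) (I : eqType)
    (g : I -> T) (s : seq I) :
  s != [::] -> exists2 a, a \in s & forall b, b \in s -> (g b <= g a)%O.
Proof.
elim: s => // a [|b s] IHs _.
  by exists a; rewrite ?mem_head // => c; rewrite inE => /eqP->.
have [//|m sm max_m] := IHs; have [le_ma|/ltW le_am] := leP (g m) (g a).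
  exists a; first exact: mem_head.
  by move=> c; rewrite inE => /predU1P[->//|/max_m/le_trans]; apply.
exists m; first by rewrite inE sm orbT.
by move=> c; rewrite inE => /predU1P[->//|/max_m].
Qed.

Section OptimizingRoots.
Variables (G : orderedZmodType) (K : fieldType) (L : closedFieldType).
Variables (iota : {rmorphism K -> L}) (wbar : {poly L} -> withInfty G).

(** A maximum is unique, so the choice made in [delta] is forced. *)
Lemma delta_optimizing_root (f : {poly K}) (a : L) :
  optimizing_root iota wbar f a -> delta iota wbar f = wbar ('X - a%:P).
Proof.
case=> fa max_a; apply: xget_subset1 => // m n [Am ubm] [An ubn].
by apply/le_anti; rewrite ubm ?ubn.
Qed.

Lemma optimizing_root_exists (f : {poly K}) :
  (1 < size f)%N -> exists a, optimizing_root iota wbar f a.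
Proof.
move=> f_gt1; have [rs def_f] := closed_field_poly_normal (map_poly iota f).
have f_neq0 : map_poly iota f != 0 by rewrite map_poly_eq0 -size_poly_gt0 ltnW.
have rootf c : root (map_poly iota f) c = (c \in rs).
  by rewrite def_f rootZ ?lead_coef_eq0 // root_prod_XsubC.
have [|a] := @total_seq_argmax _ _ _ (fun c => wbar ('X - c%:P)) rs.
  apply: contraTneq f_gt1 => rs0; rewrite -(size_map_poly iota) def_f rs0 big_nil.
  by rewrite size_scale ?size_poly1 // lead_coef_eq0.
rewrite -rootf => fa max_a; exists a; split=> //; split; first by exists a.
by move=> _ [c fc <-]; apply: max_a; rewrite -rootf.
Qed.
End OptimizingRoots.

(** * Distinguished pairs and key polynomials *)

(** Both [sigma] and its inverse [tau] preserve degrees and [vbar], so each competitor [b] of the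
    conjugate pair is pulled back to the competitor [tau b] of the original one. *)
Lemma distinguished_pair_conjugate (G : orderedZmodType) (K : fieldType)
    (L : closedFieldType) (iota : {rmorphism K -> L}) (vbar : L -> withInfty G)
    (sigma : {rmorphism L -> L}) (theta alpha : L) :
  algebraic_closure iota -> decomposition_aut iota vbar sigma ->
  distinguished_pair iota vbar theta alpha ->
  distinguished_pair iota vbar (sigma theta) (sigma alpha).
Proof.
move=> hL [[tau sigmaK tauK] sK sv] [lt_deg [_ max_a] min_a].
have degs b : deg iota (sigma b) = deg iota b by exact: deg_conjugate.
split; rewrite ?degs //.
  split; first by exists (sigma alpha); rewrite //= !degs.
  move=> _ [b /= lt_b <-]; rewrite -(tauK b) -!rmorphB !sv; apply: max_a.
  by exists (tau b) => //=; rewrite -(degs (tau b)) tauK.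
move=> b lt_b; rewrite -(tauK b) -!rmorphB !sv; apply: min_a.
by rewrite -(degs (tau b)) tauK.
Qed.

Theorem lemma6p4 (G : orderedZmodType) (K : fieldType) (L : closedFieldType)
    (iota : {rmorphism K -> L})
    (v : K -> withInfty G) (vbar : L -> withInfty G)
    (w : {poly K} -> withInfty G) (wbar : {poly L} -> withInfty G)
    (F Q : {poly K})
    (hL : algebraic_closure iota)
    (hv : field_valuation v)
    (hvbar : field_valuation vbar)
    (hvbarv : extends_to_closure iota vbar v)
    (hw : valuation w)
    (hwv : extends_to_poly v w)
    (hwbar : common_extension iota vbar w wbar)
    (hF : abstract_key_poly iota wbar F)
    (hQ : Q \is monic)
    (hFQ : distinguished_poly_pair iota vbar F Q)
    (hFh : irreducible_over (henselization iota vbar) (map_poly iota F)) :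
  (forall theta alpha : L,
      optimizing_root iota wbar F theta ->
      optimizing_root iota wbar Q alpha ->
      distinguished_pair iota vbar theta alpha) /\
  abstract_key_poly iota wbar Q.
Proof.
have [[F_gt1 _] irrQ [theta0 [alpha0 [Ft0 Qa0 dist0]]]] := hFQ.
have [wbar_val wbarC _] := hwbar.
have irrF : irreducible_poly F by case: hFQ.
have sizeE p a : irreducible_poly p -> Kroot iota p a -> (deg iota a).+1 = size p.
  move=> irr_p pa; rewrite (deg_irreducible irr_p pa) prednK // size_poly_gt0.
  exact: irredp_neq0.
have key theta b : optimizing_root iota wbar F theta ->
    (deg iota b < deg iota theta)%N ->
    wbar ('X - b%:P) = vbar (theta - b).
  (* The key property of [F] is tested on the minimal polynomial [p] of [b], whose size [deg b + 1]
     is below that of [F]; an optimizing root of [p] bounds the value at [b]. *)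
  move=> opt_t lt_b; have [p [irr_p pb sz_p]] := minimal_polynomial hL b.
  have [p_gt1 _] := irr_p; have [a opt_a] := optimizing_root_exists iota wbar p_gt1.
  have := hF.2 p; rewrite p_gt1 sz_p -(sizeE _ _ irrF opt_t.1) ltnS lt_b => /(_ isT).
  rewrite (delta_optimizing_root opt_a) (delta_optimizing_root opt_t) => lt_at.
  have lt_bt : wbar ('X - b%:P) < wbar ('X - theta%:P).
    by apply: le_lt_trans lt_at; apply: opt_a.2.2; exists b.
  (* The constant [theta - b] is [('X - b) - ('X - theta)], and the second term has strictly larger
     value. *)
  rewrite -wbarC -(valuationD_lt wbar_val (y := - ('X - theta%:P))) ?valuationN //.
  by congr (wbar _); rewrite opprB addrC addrA subrK polyCB.
have conj theta : optimizing_root iota wbar F theta ->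
    exists2 alpha, Kroot iota Q alpha & distinguished_pair iota vbar theta alpha.
  move=> [Ft _]; have [sg Dsg <-] := irreducible_henselization_transitive hL hFh Ft0 Ft.
  exists (sg alpha0); last exact: distinguished_pair_conjugate.
  by case: Dsg => _ sgK _; exact: rmorph_Kroot.
have degQ a b : Kroot iota Q a -> Kroot iota Q b -> deg iota a = deg iota b.
  by move=> Qa Qb; rewrite !(deg_irreducible irrQ).
split=> [theta alpha opt_t opt_a|].
  have [a1 Qa1 [lt1 [_ max1] min1]] := conj _ opt_t.
  have degE : deg iota alpha = deg iota a1 by apply: degQ => //; case: opt_a.
  (* One inequality is the maximality of [a1] among elements of degree below [deg theta]; the other
     is the optimality of [alpha] among the roots of [Q], translated by [key]. *)
  have eqv : vbar (theta - alpha) = vbar (theta - a1).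
    apply/le_anti/andP; split.
      by apply: max1; exists alpha; rewrite //= degE.
    rewrite -!(key theta) ?degE //; apply: opt_a.2.2; by exists a1.
  split; rewrite ?eqv ?degE //; split=> //.
  by exists alpha; rewrite //= degE.
split=> // f /andP[f_gt1 lt_fQ].
have [theta opt_t] := optimizing_root_exists iota wbar F_gt1.
have [a1 Qa1 [lt1 _ min1]] := conj _ opt_t.
have [Q_gt1 _] := irrQ; have [alpha opt_a] := optimizing_root_exists iota wbar Q_gt1.
have [eta opt_e] := optimizing_root_exists iota wbar f_gt1.
have lt_e1 : (deg iota eta < deg iota a1)%N.
  rewrite -ltnS (sizeE _ _ irrQ Qa1); apply: leq_ltn_trans lt_fQ.
  by apply: deg_root_lt opt_e.1 => //; rewrite -size_poly_gt0 ltnW.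
rewrite (delta_optimizing_root opt_a) (delta_optimizing_root opt_e).
(* The partner [a1] of [theta] serves as intermediate value: by [key], the strict inequality is the
   minimality of [deg a1] in the distinguished pair, applied to [eta]. *)
apply: lt_le_trans (_ : _ < wbar ('X - a1%:P)) _; last by apply: opt_a.2.2; exists a1.
rewrite !(key theta) ?(ltn_trans lt_e1) //; exact: min1.
Qed.
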